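(* Let $m_1,m_2,n$ be positive integers with $m_1+1=nm_2$. Then the Kronecker MLE exists uniquely for a sample $(Y_1,\dots,Y_n)$ of $n$ generic matrices in $\mathbb{R}^{m_1\times m_2}$ if and only if $n\ge m_2$, in which case the Kronecker MLE is (for generic data) a rational function of the sample $(Y_1,\dots,Y_n)$.
   Context: $\mathrm{PD}(m)$ denotes the cone of real symmetric positive definite $m\times m$ matrices. The Kronecker covariance model for a random matrix $Y\in\mathbb{R}^{m_1\times m_2}$ assumes that the column-wise vectorization of $Y$ is $\mathcal{N}(0,\Sigma_2\otimes\Sigma_1)$ with $\Sigma_j\in\mathrm{PD}(m_j)$. In terms of the concentration matrices $K_j=\Sigma_j^{-1}$, the log-likelihood of an i.i.d. sample $Y_1,\dots,Y_n$ is, up to additive and multiplicative constants, $$\ell(K_2\otimes K_1)=nm_2\log\det(K_1)+nm_1\log\det(K_2)-\operatorname{tr}\Big(\sum_{i=1}^n K_1Y_iK_2Y_i^\top\Big).$$ The Kronecker MLE is the maximizer of $\ell$ over the set $\{K_2\otimes K_1: K_1\in\mathrm{PD}(m_1),K_2\in\mathrm{PD}(m_2)\}$ (equivalently, the corresponding covariance matrix $\Sigma_2\otimes\Sigma_1=(K_2\otimes K_1)^{-1}$); it exists uniquely if there is exactly one matrix $K_2\otimes K_1$ attaining the maximum (the factors themselves are only determined up to $(K_2,K_1)\mapsto(cK_2,c^{-1}K_1)$, $c>0$). A property of data $y\in\mathbb{R}^N$ (here $N=nm_1m_2$) holds generically, or for generic $y$, if there is a proper algebraic variety $V\subsetneq\mathbb{R}^N$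 such that the property holds for all $y\in\mathbb{R}^N\setminus V$. The MLE being a rational function of the sample means that, for generic data, its matrix entries are given by rational functions of the entries of $Y_1,\dots,Y_n$. *)

(* Defs.v *)
From HB Require Import structures.
From mathcomp Require Import all_boot all_order all_algebra.
From mathcomp Require Import classical_sets reals exp.
From mathcomp Require Import mxtens.
(* Its notations clash with those of MathComp-Analysis. *)
From mathcomp Require Import -(notations) mpoly.

Set Implicit Arguments.
Unset Strict Implicit.
Unset Printing Implicit Defensive.

Import Order.TTheory GRing.Theory Num.Theory.
Local Open Scope classical_set_scope.
Local Open Scope ring_scope.

Definition PD (R : realType) (m : nat) (K : 'M[R]_m) : Prop :=
  K^T = K /\ forall x : 'cV[R]_m, x != 0 -> 0 < (x^T *m K *m x) 0 0.

(* The log-likelihood as a function of a pair of factors. On positive definite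
   pairs it depends on [K2 *t K1] only: the factors of a Kronecker product are
   determined up to [(c *: K2, c^-1 *: K1)], and this substitution with [0 < c]
   leaves both the log-determinant part and the trace unchanged. *)
Definition loglik (R : realType) (m1 m2 n : nat) (Y : 'I_n -> 'M[R]_(m1, m2))
    (K1 : 'M[R]_m1) (K2 : 'M[R]_m2) : R :=
  (n * m2)%:R * ln (\det K1) + (n * m1)%:R * ln (\det K2)
  - \tr (\sum_(i < n) K1 *m Y i *m K2 *m (Y i)^T).

(* [K] is a maximizer of the log-likelihood over the matrices [K2 *t K1] with
   positive definite factors. *)
Definition is_kronecker_MLE (R : realType) (m1 m2 n : nat)
    (Y : 'I_n -> 'M[R]_(m1, m2)) (K : 'M[R]_(m2 * m1)) : Prop :=
  exists K1 : 'M[R]_m1, exists K2 : 'M[R]_m2,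
    [/\ PD K1, PD K2, K = K2 *t K1 &
        forall (L1 : 'M[R]_m1) (L2 : 'M[R]_m2), PD L1 -> PD L2 ->
          loglik Y L1 L2 <= loglik Y K1 K2].

(* The value at [y] of a polynomial in [N] variables. *)
Definition peval (R : realType) (N : nat) (p : mpoly N R) (y : 'rV[R]_N) :
    R := meval (fun k => y 0 k) p.

Definition algebraic_variety (R : realType) (N : nat) (V : set 'rV[R]_N) : Prop :=
  exists ps : seq (mpoly N R),
    V = [set y : 'rV[R]_N | forall p : mpoly N R, p \in ps -> peval p y = 0].

Definition generically (R : realType) (N : nat) (P : 'rV[R]_N -> Prop) : Prop :=
  exists V : set 'rV[R]_N,
    [/\ algebraic_variety V, V <> setT & forall y, ~ V y -> P y].

(* A point of R^(n * (m1 * m2)) read as a sample of n matrices; inverse to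
   [fun Y => mxvec (\matrix_(i < n) mxvec (Y i))]. *)
Definition sample_of (R : realType) (m1 m2 n : nat) (y : 'rV[R]_(n * (m1 * m2))) :
    'I_n -> 'M[R]_(m1, m2) :=
  fun i => vec_mx (row i (vec_mx y)).

Definition kronecker_MLE_generically_unique (R : realType) (m1 m2 n : nat) :
    Prop :=
  generically (fun y : 'rV[R]_(n * (m1 * m2)) =>
    exists! K : 'M[R]_(m2 * m1), is_kronecker_MLE (sample_of y) K).

(* The entries of the MLE are given, for generic data, by quotients [p a b / q a b]
   of fixed polynomials. The nonvanishing of [q a b] is needed since [x / 0 = 0]. *)
Definition kronecker_MLE_rational (R : realType) (m1 m2 n : nat) : Prop :=
  exists p q : 'I_(m2 * m1) -> 'I_(m2 * m1) -> mpoly (n * (m1 * m2)) R,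
    generically (fun y : 'rV[R]_(n * (m1 * m2)) =>
      (forall a b, peval (q a b) y != 0) /\
      is_kronecker_MLE (sample_of y)
        (\matrix_(a, b) (peval (p a b) y / peval (q a b) y))).

(* Main.v *)
(* Write Y = [Y_1 ... Y_n], of size m1 x (m1 + 1). Its maximal minors form a
   vector v with Y v = 0 and, for positive definite A,
     det (Y A Y^T) = det A * (v^T A^-1 v).
   For fixed K2 the likelihood is maximal at K1 = n m2 (Y (1 (x) K2) Y^T)^-1, and
   by this identity the profile likelihood of K2 is, up to a constant,
     n ln det K2^-1 - n m2 ln tr (K2^-1 S),   S = sum_i v_i v_i^T,
   where the v_i in R^m2 are the n consecutive blocks of v. If S is invertible,
   AM-GM for the eigenvalues of K2^-1 S shows that the maximum is attained exactly
   at the multiples of K2 = S, whose entries are polynomials in the data. If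
   n < m2, then S is singular and det K2^-1 can be increased without changing
   tr (K2^-1 S). *)
Require Import Defs.
From mathcomp Require Import all_boot all_order all_algebra.
From mathcomp Require Import reals.
From mathcomp Require Import boolp classical_sets sequences exp mxtens zify ring lra.
From mathcomp Require Import -(notations) mpoly.

Set Implicit Arguments.
Unset Strict Implicit.
Unset Printing Implicit Defensive.

Import Order.TTheory GRing.Theory Num.Theory.
Local Open Scope ring_scope.

(** * Linear algebra *)

Lemma mulmx_vanish (F : fieldType) (p q : nat) (A : 'M[F]_(p, q)) :
  (\rank A < q)%N -> exists2 x : 'cV_q, x != 0 & A *m x = 0.
Proof.
move=> rkA; pose K := kermx A^T.
have K0 : K != 0 by rewrite kermx_eq0 /row_free mxrank_tr neq_ltn rkA.
exists (nz_row K)^T; first by rewrite trmx_eq0 nz_row_eq0.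
by apply: trmx_inj; rewrite trmx_mul trmxK trmx0; apply/sub_kermxP/nz_row_sub.
Qed.

Lemma unitmx_inj (F : fieldType) (m : nat) (A : 'M[F]_m) :
  reflect (forall x : 'cV_m, A *m x = 0 -> x = 0) (A \in unitmx).
Proof.
apply: (iffP idP) => [uA x Ax0|injA].
  by rewrite -[x](mulKmx uA) Ax0 mulmx0.
rewrite -row_full_unit; apply: contraT => nfA.
have rkA : (\rank A < m)%N by rewrite ltn_neqAle nfA rank_leq_col.
by have [x /[swap] /injA -> /eqP] := mulmx_vanish rkA.
Qed.

(** * Kronecker products and the kernel vector of maximal minors *)

Section Tensor.
Variable R : comPzRingType.

Lemma tensmx11 (n m : nat) : (1%:M : 'M[R]_n) *t (1%:M : 'M[R]_m) = 1%:M.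
Proof.
apply/matrixP => i j; case: (mxtens_indexP i) => i1 i2.
case: (mxtens_indexP j) => j1 j2; rewrite tensmxE !mxE -natrM mulnb.
by rewrite (can_eq (@mxtens_indexK _ _)) xpair_eqE.
Qed.

Lemma tens1mx_inv (n m : nat) (L K : 'M[R]_m) : L *m K = 1%:M ->
  ((1%:M : 'M_n) *t L) *m (1%:M *t K) = 1%:M.
Proof. by move=> LK; rewrite tensmx_mul mulmx1 LK tensmx11. Qed.

Lemma det_castmx (p q : nat) (e1 e2 : p = q) (A : 'M[R]_p) :
  \det (castmx (e1, e2) A) = \det A.
Proof. by case: q / e1 e2 => e2; rewrite (eq_irrelevance e2 erefl) castmx_id. Qed.

Lemma det_tens1mx (n m : nat) (L : 'M[R]_m) :
  \det ((1%:M : 'M_n) *t L) = \det L ^+ n.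
Proof.
elim: n => [|n IH]; first by rewrite det_mx00.
rewrite -[n.+1]/(1 + n)%N scalar_mx_block tens_block_mx det_castmx.
by rewrite !tens0mx det_ublock IH tens_scalar1mx det_castmx exprS.
Qed.

Lemma sum_mxtens_index (n m : nat) (F : 'I_(n * m) -> R) :
  \sum_k F k = \sum_i \sum_j F (mxtens_index (i, j)).
Proof.
rewrite pair_big /= (reindex (@mxtens_index n m)) /=.
  by apply: eq_bigr => -[].
exists (@mxtens_unindex n m) => k _; first exact: mxtens_indexK.
exact: mxtens_unindexK.
Qed.

Definition hstack (m1 m2 n : nat) (Y : 'I_n -> 'M[R]_(m1, m2)) : 'M_(m1, n * m2) :=
  \matrix_(a, k) Y (mxtens_unindex k).1 a (mxtens_unindex k).2.

(** The matrix [1%:M *t L] is block diagonal with [n] copies of [L], so a sum over the sample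
    becomes a single congruence by [[Y_1 ... Y_n]]. *)
Lemma sum_mul_hstack (m1 m2 n : nat) (Y : 'I_n -> 'M[R]_(m1, m2)) (L : 'M_m2) :
  \sum_i Y i *m L *m (Y i)^T = hstack Y *m (1%:M *t L) *m (hstack Y)^T.
Proof.
have -> : hstack Y *m (1%:M *t L) = hstack (fun i => Y i *m L).
  apply/matrixP => a k; case: (mxtens_indexP k) => i j.
  rewrite mxE sum_mxtens_index mxE mxtens_indexK mxE (bigD1 i) //=.
  rewrite [X in _ + X]big1 ?addr0 => [|i' ne].
    by apply: eq_bigr => j' _; rewrite tensmxE !mxE mxtens_indexK eqxx mul1r.
  by rewrite big1 // => j' _; rewrite tensmxE !mxE (negbTE ne) mul0r mulr0.
apply/matrixP => a b; rewrite summxE mxE sum_mxtens_index.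
apply: eq_bigr => i _; rewrite mxE; apply: eq_bigr => j _.
by rewrite !mxE mxtens_indexK.
Qed.

(** Appending the row [e_j] picks out the signed maximal minor without column [j], with no explicit
    signs or deletions. The equation [e] is an argument because [n * m2] is not convertible to
    [m1 + 1]. *)
Definition kervec (m N : nat) (e : (m + 1)%N = N) (Y : 'M[R]_(m, N)) : 'cV[R]_N :=
  \col_j \det (castmx (e, erefl N) (col_mx Y (delta_mx 0 j))).

(** Laplace expansion along the last row: the vector of minors is a generalized cross product of the
    rows of [Y]. *)
Lemma det_kervec (m N : nat) (e : (m + 1)%N = N) (Y : 'M[R]_(m, N)) (x : 'rV_N) :
  \det (castmx (e, erefl N) (col_mx Y x)) = (x *m kervec e Y) 0 0.
Proof.
case: N / e Y x => Y x; rewrite castmx_id mxE (expand_det_row _ (rshift m 0)).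
apply: eq_bigr => j _; rewrite col_mxEd; congr (_ * _).
rewrite mxE castmx_id (expand_det_row _ (rshift m 0)) (bigD1 j) //= big1.
  rewrite addr0 col_mxEd mxE !eqxx mul1r; congr (_ * \det _).
  (* Both cofactors delete the last row, so only rows of [Y] remain and the other case is
     contradictory. *)
  apply/matrixP => i k; rewrite !mxE; case: splitP => // i' /= ii'.
  exfalso; move: (ltn_ord i); rewrite ord1 /= in ii'.
  move: ii'; rewrite /bump; case: leqP => /= + H; lia.
by move=> k kj; rewrite col_mxEd mxE (negbTE kj) andbF mul0r.
Qed.

(** Pairing a row of [Y] with the vector of minors gives a determinant with a repeated row. *)
Lemma mul_kervec (m N : nat) (e : (m + 1)%N = N) (Y : 'M[R]_(m, N)) :
  Y *m kervec e Y = 0.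
Proof.
apply/colP => i; rewrite [RHS]mxE.
have -> : (Y *m kervec e Y) i 0 = (row i Y *m kervec e Y) 0 0.
  by rewrite -row_mul [RHS]mxE.
rewrite -det_kervec; case: N / e Y => Y; rewrite castmx_id.
apply: (determinant_alternate (i1 := lshift 1 i) (i2 := rshift m 0)) => [|k].
  by rewrite eq_lrshift.
by rewrite col_mxEu col_mxEd mxE.
Qed.

(* [W] below appends the row [v^T A^-1] to [Y], where [v] spans the kernel of
   [Y]: then [W A W^T] is block diagonal, and [\det W = v^T A^-1 v]. *)
Lemma det_congr_kervec (m N : nat) (e : (m + 1)%N = N) (Y : 'M[R]_(m, N))
    (A B : 'M[R]_N) (s := ((kervec e Y)^T *m B *m kervec e Y) 0 0) :
  A *m B = 1%:M -> B^T = B -> \det (Y *m A *m Y^T) * s = s ^+ 2 * \det A.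
Proof.
rewrite {}/s; set v := kervec e Y => AB symB.
pose W := castmx (e, erefl N) (col_mx Y (v^T *m B)).
have detW : \det W = (v^T *m B *m v) 0 0 by rewrite det_kervec.
have BA := mulmx1C AB.
transitivity (\det (W *m A *m W^T)); last first.
  by rewrite !det_mulmx det_tr detW; ring.
have Yv := mul_kervec e Y; rewrite -/v in Yv.
rewrite {detW}/W; clearbody v; case: N / e Y A B v AB symB BA Yv => Y A B v.
move=> AB symB BA Yv; rewrite castmx_id mul_col_mx tr_col_mx mul_col_row.
have -> : Y *m A *m (v^T *m B)^T = 0.
  by rewrite trmx_mul trmxK symB mulmxA -(mulmxA Y) AB mulmx1.
rewrite det_lblock trmx_mul trmxK symB -[v^T *m B *m A]mulmxA BA mulmx1.
by rewrite mulmxA det_mx11.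
Qed.

End Tensor.

(** * Positive definite matrices and log-determinants *)

Section PositiveDefinite.
Variable R : realType.

Lemma dotmx_ge0 (m : nat) (x : 'cV[R]_m) : 0 <= (x^T *m x) 0 0.
Proof. by rewrite mxE sumr_ge0 // => i _; rewrite mxE -expr2 sqr_ge0. Qed.

Lemma dotmx_eq0 (m : nat) (x : 'cV[R]_m) : ((x^T *m x) 0 0 == 0) = (x == 0).
Proof.
apply/idP/eqP => [|->]; last by rewrite mulmx0 mxE.
rewrite mxE psumr_eq0 => [/allP x0|i _]; last by rewrite mxE -expr2 sqr_ge0.
apply/colP => i; apply/eqP; move: (x0 i); rewrite mem_index_enum => /(_ isT).
by rewrite !mxE mulf_eq0 orbb.
Qed.

Lemma PD1 (m : nat) : PD (1%:M : 'M[R]_m).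
Proof.
split=> [|x x0]; first exact: trmx1.
by rewrite mulmx1 lt_neqAle eq_sym dotmx_eq0 x0 dotmx_ge0.
Qed.

Lemma PD_congr (m p : nat) (K : 'M[R]_m) (B : 'M[R]_(m, p)) :
  PD K -> (forall x : 'cV_p, B *m x = 0 -> x = 0) -> PD (B^T *m K *m B).
Proof.
move=> [symK posK] injB; split=> [|x x0].
  by rewrite !trmx_mul trmxK symK mulmxA.
have -> : x^T *m (B^T *m K *m B) *m x = (B *m x)^T *m K *m (B *m x).
  by rewrite trmx_mul !mulmxA.
by apply: posK; apply: contraNneq x0 => /injB ->.
Qed.

Lemma PD_unit (m : nat) (K : 'M[R]_m) : PD K -> K \in unitmx.
Proof.
move=> [_ posK]; apply/unitmx_inj => x Kx0; apply/eqP/contraT => /posK.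
by rewrite -mulmxA Kx0 mulmx0 mxE ltxx.
Qed.

Lemma PD_inv (m : nat) (K : 'M[R]_m) : PD K -> PD (invmx K).
Proof.
move=> pdK; have uK := PD_unit pdK; case: (pdK) => symK _.
have -> : invmx K = (invmx K)^T *m K *m invmx K.
  by rewrite -mulmxA mulmxV // mulmx1 trmx_inv symK.
by apply: PD_congr => //; apply/unitmx_inj; rewrite unitmx_inv.
Qed.

Lemma PD_scale (m : nat) (c : R) (K : 'M[R]_m) : 0 < c -> PD K -> PD (c *: K).
Proof.
move=> c0 [symK posK]; split=> [|x x0]; first by rewrite linearZ /= symK.
by rewrite -scalemxAr -scalemxAl mxE mulr_gt0 // posK.
Qed.

Lemma PD_rank1_update (m : nat) (K : 'M[R]_m) (x : 'cV_m) :
  PD K -> PD (K + x *m x^T).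
Proof.
move=> [symK posK]; split=> [|y y0].
  by rewrite linearD /= symK trmx_mul trmxK.
rewrite mulmxDr mulmxDl mxE ltr_wpDr ?posK //.
have -> : y^T *m (x *m x^T) *m y = (x^T *m y)^T *m (x^T *m y).
  by rewrite trmx_mul trmxK !mulmxA.
exact: dotmx_ge0.
Qed.

Lemma ln_leif (x : R) : 0 < x -> ln x <= x - 1 ?= iff (x == 1).
Proof.
move=> x0; have [->|x1] := eqVneq x 1; first by rewrite ln1 subrr; apply/leif_refl.
have ln0 : ln x != 0.
  by apply: contra x1 => /eqP ln0; rewrite -(lnK x0) ln0 expR0.
have := expR_gt1Dx ln0; rewrite lnK // => lt.
by apply/leifP; lra.
Qed.

(** Induction through the Schur complement [S] of the corner entry [a]: the determinant is
    [a * \det S] and the trace is [a + \tr S] plus a nonnegative off-diagonal term. The bound on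
    [ln (\det A)] is AM-GM for the eigenvalues, obtained without diagonalization. *)
Lemma PD_cholesky (m : nat) (A : 'M[R]_m) : PD A ->
  [/\ 0 < \det A, ln (\det A) <= \tr A - m%:R ?= iff (A == 1%:M)
    & exists2 C : 'M[R]_m, C \in unitmx & A = C^T *m C].
Proof.
elim: m A => [|m IH] A pdA.
  split; last by exists 1%:M; rewrite ?unitmx1 //; apply/matrixP => -[].
    by rewrite det_mx00.
  rewrite det_mx00 ln1 /mxtrace big_ord0 subrr (_ : A == _).
    exact/leif_refl.
  by apply/eqP/matrixP => -[].
move: A pdA; rewrite -[m.+1]/(1 + m)%N => A pdA.
pose a := A 0 0; pose b := dlsubmx A; pose D := drsubmx A.
case: (pdA) => symA posA.
have defA : A = block_mx a%:M b^T b D.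
  rewrite -[LHS]submxK [ulsubmx A]mx11_scalar trmx_dlsub symA.
  by congr (block_mx _%:M _ _ _); rewrite !mxE; congr (A _ _); apply: val_inj.
have a0 : 0 < a.
  have := posA (col_mx 1%:M 0).
  rewrite defA tr_col_mx trmx1 trmx0 mul_row_block mul_row_col.
  rewrite !mul1mx !mul0mx !mulmx1 mulmx0 !addr0 mxE eqxx mulr1n; apply.
  apply/eqP => /(congr1 usubmx); rewrite col_mxKu linear0 => /matrixP/(_ 0 0).
  by rewrite !mxE; apply/eqP; rewrite oner_neq0.
pose S := D - a^-1 *: (b *m b^T).
have symD : D^T = D by rewrite /D trmx_drsub symA.
have pdS : PD S.
  (* The columns of [B] are orthogonal to the first basis vector for the form [A], so congruence by
     [B] leaves the Schur complement. *)
  pose B := col_mx (- a^-1 *: b^T) (1%:M : 'M_m).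
  have -> : S = B^T *m A *m B.
    rewrite defA tr_col_mx trmx1 linearZ /= trmxK mul_row_block mul_row_col.
    rewrite !mul1mx mulmx1 mul_mx_scalar scalerA mulrN divff ?gt_eqF //.
    by rewrite scaleN1r addNr mul0mx add0r -scalemxAl scaleNr addrC.
  apply: PD_congr => // x; rewrite mul_col_mx mul1mx => /(congr1 dsubmx).
  by rewrite col_mxKd linear0.
have [detS0 leS [C uC defS]] := IH S pdS.
pose r := Num.sqrt a.
have r0 : r != 0 by rewrite gt_eqF // sqrtr_gt0.
have rr : r * r = a by rewrite -expr2 sqr_sqrtr ?ltW.
pose C1 := block_mx (r%:M : 'M_1) (r^-1 *: b^T) 0 C.
have defC1 : A = C1^T *m C1.
  rewrite tr_block_mx tr_scalar_mx trmx0 linearZ /= trmxK mulmx_block.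
  rewrite !mulmx0 !mul0mx !addr0 -!scalar_mxM rr mul_mx_scalar mul_scalar_mx.
  rewrite !scalerA divff // !scale1r -defS -scalemxAl -scalemxAr scalerA.
  by rewrite -invfM rr addrC subrK.
have detC1 : \det A = a * \det S.
  rewrite defC1 defS !det_mulmx !det_tr det_ublock det_scalar1 -rr; ring.
split; last 1 first.
- exists C1 => //; rewrite unitmxE det_ublock det_scalar1 unitrM -unitmxE uC.
  by rewrite unitfE r0.
- by rewrite detC1 mulr_gt0.
have trA : \tr A = a + \tr S + a^-1 * (b^T *m b) 0 0.
  rewrite {1}defA mxtrace_block mxtrace_scalar mulr1n linearB /= linearZ /=.
  by rewrite mxtrace_mulC [X in _ * X]trace_mx11 addrA addrNK.
have := leifD (ln_leif a0) leS.
rewrite -lnM ?posrE // -detC1 => le1.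
(* This term accounts for the off-diagonal block: equality in the sum of the three bounds forces
   [a = 1], [S = 1] and [b = 0]. *)
have le2 : 0 <= a^-1 * (b^T *m b) 0 0 ?= iff (b == 0).
  apply/leifP; rewrite -dotmx_eq0; case: eqP => [->|/eqP b0].
    by rewrite mulr0.
  by rewrite mulr_gt0 ?invr_gt0 // lt_neqAle eq_sym b0 dotmx_ge0.
have := leifD le1 le2; rewrite addr0.
have -> : a - 1 + (\tr S - m%:R) + a^-1 * (b^T *m b) 0 0 = \tr A - (1 + m)%N%:R.
  by rewrite trA natrD; ring.
congr (_ <= _ ?= iff _).
apply/andP/eqP => [[/andP[/eqP a1 /eqP S1] /eqP b0]|A1].
  by rewrite defA b0 trmx0 -[D](subrK (a^-1 *: (b *m b^T))) -/S S1 b0 mul0mx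
    scaler0 addr0 a1 -scalar_mx_block.
have a1 : a = 1 by rewrite /a A1 mxE eqxx.
have b0 : b = 0 by rewrite /b A1 scalar_mx_block block_mxKdl.
by rewrite /S /D A1 scalar_mx_block block_mxKdr b0 mul0mx scaler0 subr0 a1 !eqxx.
Qed.

Lemma PD_det_gt0 (m : nat) (A : 'M[R]_m) : PD A -> 0 < \det A.
Proof. by case/PD_cholesky. Qed.

(** The product [A *m B] need not be symmetric, but with [A = C^T *m C] the positive definite matrix
    [C *m B *m C^T] has the same trace and determinant. *)
Lemma logdet_mul_leif (m : nat) (A B : 'M[R]_m) : PD A -> PD B ->
  ln (\det A) + ln (\det B) <= \tr (A *m B) - m%:R ?= iff (A *m B == 1%:M).
Proof.
move=> pdA pdB; have [dA _ [C uC defA]] := PD_cholesky pdA.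
have pdX : PD (C *m B *m C^T).
  rewrite -{1}[C]trmxK; apply: PD_congr => //.
  by apply/unitmx_inj; rewrite unitmx_tr.
have [_ + _] := PD_cholesky pdX.
have -> : \tr (C *m B *m C^T) = \tr (A *m B).
  by rewrite (mxtrace_mulC (C *m B)) mulmxA -defA.
rewrite -lnM ?posrE ?PD_det_gt0 //.
have -> : \det (C *m B *m C^T) = \det A * \det B.
  by rewrite defA !det_mulmx; ring.
congr (_ <= _ ?= iff _); rewrite defA.
apply/eqP/eqP => [/mulmx1C|].
  by rewrite mulmxA => <-.
by rewrite -mulmxA => /mulmx1C.
Qed.

(** Rescaling [A] by [c^-1] moves the equality case to [c%:M]. It serves with [c = n * m2] to
    maximize over the first factor, and with [c] the mean eigenvalue to maximize over the second. *)
Lemma logdet_mul_scaled_leif (m : nat) (c : R) (A B : 'M[R]_m) :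
  0 < c -> PD A -> PD B ->
  ln (\det A) + ln (\det B) <= m%:R * ln c + c^-1 * \tr (A *m B) - m%:R
    ?= iff (A *m B == c%:M).
Proof.
move=> c0 pdA pdB; have ci0 : 0 < c^-1 by rewrite invr_gt0.
have := logdet_mul_leif (PD_scale ci0 pdA) pdB.
rewrite detZ lnM ?posrE ?exprn_gt0 ?PD_det_gt0 // lnXn // lnV ?posrE //.
rewrite -scalemxAl linearZ /= => le.
have lnc : m%:R * ln c <= m%:R * ln c ?= iff true by apply/leif_refl.
have := leifD lnc le; rewrite /= mulNrn -[ln c *+ m]mulr_natl.
rewrite !addrA subrr add0r; congr (_ <= _ ?= iff _).
rewrite -scalemx1 -(inj_eq (scalerI (lt0r_neq0 c0))) scalerA divff ?lt0r_neq0 //.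
by rewrite !scale1r scalemx1.
Qed.

(** Apply [logdet_mul_leif] to [invmx L] and [K]: the trace of their product is [m - x^T L^-1 x],
    which is strictly less than [m]. *)
Lemma ln_det_rank1_update (m : nat) (K : 'M[R]_m) (x : 'cV_m) :
  PD K -> x != 0 -> ln (\det K) < ln (\det (K + x *m x^T)).
Proof.
move=> pdK x0; set L := K + _.
have pdL : PD L by exact: PD_rank1_update.
have uL := PD_unit pdL; have pdL' := PD_inv pdL.
have [le _] := logdet_mul_leif pdL' pdK.
have gt0 : 0 < (x^T *m invmx L *m x) 0 0 by have [_] := pdL'; apply.
have trE : \tr (invmx L *m K) = m%:R - (x^T *m invmx L *m x) 0 0.
  have -> : K = L - x *m x^T by rewrite addrK.
  by rewrite mulmxBr mulVmx // linearB /= mxtrace1 mulmxA mxtrace_mulC mulmxA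
    trace_mx11.
by move: le; rewrite trE det_inv lnV ?posrE ?PD_det_gt0 //; lra.
Qed.

Lemma PD_tens1 (n m : nat) (L : 'M[R]_m) : PD L -> PD ((1%:M : 'M_n) *t L).
Proof.
move=> pdL; have [_ _ [C uC ->]] := PD_cholesky pdL.
have -> : (1%:M : 'M[R]_n) *t (C^T *m C) =
    ((1%:M : 'M_n) *t C)^T *m 1%:M *m ((1%:M : 'M_n) *t C).
  by rewrite mulmx1 trmx_tens tensmx_mul trmx1 mulmx1.
apply: PD_congr (PD1 _) _; apply/unitmx_inj.
by have /mulmx1_unit[] := tens1mx_inv n (mulmxV uC).
Qed.

End PositiveDefinite.

(** Carries a matrix inequality, with its equality case, over to the log-likelihood, whose gap to
    its bound is a positive multiple of the original gap. *)
Lemma leif_scaled_gap (F : realFieldType) (c x y x' y' : F) (C : bool) :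
  0 < c -> y' - x' = c * (y - x) -> x <= y ?= iff C -> x' <= y' ?= iff C.
Proof.
move=> c0 gap [le eqC]; split; first by rewrite -subr_ge0 gap pmulr_rge0 // subr_ge0.
by rewrite eq_sym -subr_eq0 gap mulf_eq0 gt_eqF //= subr_eq0 eq_sym.
Qed.

(** * Prescribed values and vanishing of the kernel vector *)

Lemma kervec_row_mx (R : comPzRingType) (m : nat) (w : 'cV[R]_m) :
  kervec erefl (row_mx 1%:M (- w)) = col_mx w 1%:M.
Proof.
apply/colP => j; rewrite mxE castmx_id.
rewrite -[delta_mx 0 j]hsubmxK -[col_mx (row_mx _ _) _]/(block_mx _ _ _ _).
set x := lsubmx _; set t := rsubmx _.
(* Block elimination below the identity leaves the scalar [t + x *m w] as determinant, the product
   of [e_j] with the claimed vector. *)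
have -> : block_mx 1%:M (- w) x t =
    block_mx 1%:M 0 x 1%:M *m block_mx 1%:M (- w) 0 (t + x *m w).
  rewrite mulmx_block !mul1mx !mulmx1 !mul0mx !addr0 mulmxN.
  by rewrite addrCA addNr addr0.
rewrite det_mulmx det_lblock det_ublock !det1 !mul1r det_mx11.
have -> : t + x *m w = delta_mx 0 j *m col_mx w 1%:M.
  by rewrite -[delta_mx 0 j]hsubmxK mul_row_col mulmx1 addrC.
by rewrite -rowE mxE.
Qed.

Lemma kervec_onto (R : comPzRingType) (m N : nat) (e : (m + 1)%N = N) (t : 'cV[R]_N) :
  t (cast_ord e (rshift m 0)) 0 = 1 -> exists Y : 'M_(m, N), kervec e Y = t.
Proof.
case: N / e t => t; rewrite cast_ord_id => t1.
exists (row_mx 1%:M (- usubmx t)); rewrite kervec_row_mx -[RHS]vsubmxK.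
by congr col_mx; rewrite [RHS]mx11_scalar mxE t1.
Qed.

Section KernelVector.
Variables (R : realType) (m N : nat) (e : (m + 1)%N = N) (Y : 'M[R]_(m, N)).

(** With [A = B = 1], [det_congr_kervec] shows that [\det (Y *m Y^T)] is the squared norm of the
    kernel vector, hence nonzero. *)
Lemma kervec_neq0_inj (x : 'cV_m) : kervec e Y != 0 -> Y^T *m x = 0 -> x = 0.
Proof.
move=> v0 Yx0; have := @det_congr_kervec _ _ _ e Y 1%:M 1%:M (mulmx1 _) (trmx1 _ _).
rewrite mulmx1 mulmx1 det1 mulr1 => detYY.
have s0 : ((kervec e Y)^T *m kervec e Y) 0 0 != 0 by rewrite dotmx_eq0.
have : Y *m Y^T \in unitmx.
  rewrite unitmxE unitfE; apply: contraNneq s0 => det0.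
  by move/esym/eqP: detYY; rewrite det0 mul0r sqrf_eq0.
by move/unitmx_inj; apply; rewrite -mulmxA Yx0 mulmx0.
Qed.

(** Append to [Y] a nonzero [a^T] with [Y a = 0]. The determinant vanishes, so the rows are
    dependent; as [a] is orthogonal to the rows of [Y], the dependence involves these rows only. *)
Lemma kervec_eq0_ker : kervec e Y = 0 -> exists2 x : 'cV_m, x != 0 & Y^T *m x = 0.
Proof.
move=> v0; have [a a0 Ya] : exists2 a : 'cV_N, a != 0 & Y *m a = 0.
  by apply: mulmx_vanish; rewrite -{2}e addn1 ltnS rank_leq_row.
have := det_kervec e Y a^T; rewrite v0 mulmx0 mxE => det0.
have [z z0 Wz] : exists2 z : 'cV_(m + 1), z != 0 & (col_mx Y a^T)^T *m z = 0.
  apply: mulmx_vanish; rewrite mxrank_tr ltn_neqAle rank_leq_row andbT.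
  move: det0; case: N / e Y a {a0 Ya v0} => Y' a; rewrite castmx_id.
  move/eqP; apply: contraL => full; rewrite -unitfE -unitmxE.
  by rewrite -row_free_unit.
move: Wz z0; rewrite -[z]vsubmxK tr_col_mx trmxK mul_row_col => Wz.
have z2 : dsubmx z = 0.
  move: (congr1 (mulmx a^T) Wz); rewrite mulmx0 mulmxDr mulmxA.
  have -> : a^T *m Y^T = 0 by rewrite -trmx_mul Ya trmx0.
  rewrite mul0mx add0r mulmxA [a^T *m a]mx11_scalar mul_scalar_mx => /eqP.
  by rewrite scaler_eq0 dotmx_eq0 (negbTE a0) => /eqP.
move: Wz; rewrite z2 mulmx0 addr0 => Yz; exists (usubmx z) => //.
by apply: contraNneq z0 => ->; rewrite col_mx0.
Qed.

End KernelVector.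

(** * The profile likelihood *)

Section Gram.
Variables (m1 m2 n : nat) (e : (m1 + 1)%N = (n * m2)%N).

(** Row [i] is the block [v_i^T]. The ring is arbitrary so that the construction also applies to
    matrices of polynomials. *)
Definition kerblocks (R : comPzRingType) (Y : 'I_n -> 'M[R]_(m1, m2)) : 'M_(n, m2) :=
  \matrix_(i, j) kervec e (hstack Y) (mxtens_index (i, j)) 0.

Definition kergram (R : comPzRingType) (Y : 'I_n -> 'M[R]_(m1, m2)) : 'M_m2 :=
  (kerblocks Y)^T *m kerblocks Y.

Definition scatter (R : comPzRingType) (Y : 'I_n -> 'M[R]_(m1, m2)) (L : 'M_m2) :=
  \sum_i Y i *m L *m (Y i)^T.

(** The kernel vector is itself a stack of the rows [v_i^T], so [sum_mul_hstack] turns the quadratic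
    form into the sum of the [v_i^T L v_i]. *)
Lemma kervec_quad (R : comPzRingType) (Y : 'I_n -> 'M[R]_(m1, m2)) (L : 'M_m2)
    (v := kervec e (hstack Y)) :
  (v^T *m (1%:M *t L) *m v) 0 0 = \tr (L *m kergram Y).
Proof.
have -> : v = (hstack (fun i => row i (kerblocks Y)))^T.
  apply/colP => k; case: (mxtens_indexP k) => i j.
  by rewrite !mxE mxtens_indexK.
rewrite trmxK -sum_mul_hstack summxE mulmxA mxtrace_mulC mulmxA.
apply: eq_bigr => i _; rewrite tr_row -row_mul.
by rewrite !mxE; apply: eq_bigr => j _; rewrite !mxE.
Qed.

Section Map.
Variables (R R' : comNzRingType) (f : {rmorphism R -> R'}).
Variable Y : 'I_n -> 'M[R]_(m1, m2).

Lemma map_kergram : map_mx f (kergram Y) = kergram (fun i => map_mx f (Y i)).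
Proof.
have hE : map_mx f (hstack Y) = hstack (fun i => map_mx f (Y i)).
  by apply/matrixP => i j; rewrite !mxE.
rewrite map_mxM -map_trmx.
suff -> : map_mx f (kerblocks Y) = kerblocks (fun i => map_mx f (Y i)) by [].
apply/matrixP => i j; rewrite !mxE -det_map_mx map_castmx map_col_mx hE.
by rewrite map_delta_mx.
Qed.

Lemma map_scatter (L : 'M_m2) :
  map_mx f (scatter Y L) = scatter (fun i => map_mx f (Y i)) (map_mx f L).
Proof. by rewrite raddf_sum; apply: eq_bigr => i _; rewrite /= !map_mxM -map_trmx. Qed.

End Map.

Variable R : realType.
Variable Y : 'I_n -> 'M[R]_(m1, m2).
Let v := kervec e (hstack Y).
Let S := kergram Y.

Lemma kergram_trace_gt0 (L : 'M_m2) : v != 0 -> PD L -> 0 < \tr (L *m S).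
Proof.
by move=> v0 pdL; rewrite -kervec_quad; have [_] := PD_tens1 n pdL; apply.
Qed.

Lemma PD_scatter (L : 'M_m2) : v != 0 -> PD L -> PD (scatter Y L).
Proof.
move=> v0 pdL; rewrite /scatter sum_mul_hstack -{1}[hstack Y]trmxK.
apply: PD_congr; first exact: PD_tens1.
by move=> x; apply: kervec_neq0_inj v0.
Qed.

(** This is [det_congr_kervec] for [A = 1%:M *t L], where the trace is positive and can be
    cancelled. *)
Lemma ln_det_scatter (L : 'M_m2) : v != 0 -> PD L ->
  ln (\det (scatter Y L)) = n%:R * ln (\det L) + ln (\tr (invmx L *m S)).
Proof.
move=> v0 pdL; have pdL' := PD_inv pdL.
have tau0 := kergram_trace_gt0 v0 pdL'.
have symB : ((1%:M : 'M_n) *t invmx L)^T = 1%:M *t invmx L.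
  by have [] := PD_tens1 n pdL'.
have AB := tens1mx_inv n (mulmxV (PD_unit pdL)).
have := det_congr_kervec e (hstack Y) AB symB; rewrite kervec_quad.
rewrite -sum_mul_hstack -/(scatter Y L) det_tens1mx expr2 -mulrA mulrCA mulrC.
move/(mulfI (lt0r_neq0 tau0)) => ->.
by rewrite lnM ?posrE ?exprn_gt0 ?PD_det_gt0 // lnXn ?PD_det_gt0 // mulr_natl addrC.
Qed.

Lemma loglik_profile (c := (n * m2)%:R : R) (L1 : 'M_m1) (L2 : 'M_m2) :
  0 < c -> v != 0 -> PD L1 -> PD L2 ->
  loglik Y L1 L2 <= c * (m1%:R * ln c - m1%:R) - n%:R * ln (\det L2)
                    - c * ln (\tr (invmx L2 *m S))
    ?= iff (L1 *m scatter Y L2 == c%:M).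
Proof.
move=> c0 v0 pd1 pd2.
apply: (leif_scaled_gap c0 _ (logdet_mul_scaled_leif c0 pd1 (PD_scatter v0 pd2))).
rewrite ln_det_scatter // /loglik -/c.
have -> : \sum_i L1 *m Y i *m L2 *m (Y i)^T = L1 *m scatter Y L2.
  by rewrite mulmx_sumr; apply: eq_bigr => i _; rewrite !mulmxA.
(* The dimension equation makes the coefficient of [ln (\det L2)], which is [n * m1 - n * c], equal
   to [- n]. *)
have m1E : m1%:R = c - 1 by rewrite /c -e natrD addrK.
rewrite natrM {}m1E; clearbody c; field.
exact: lt0r_neq0.
Qed.

Lemma PD_kergram_neq0 : (0 < m2)%N -> PD S -> v != 0.
Proof.
move=> m2_gt0 /PD_unit uS; apply: contraL uS => /eqP v0.
have -> : S = 0.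
  rewrite /S /kergram; have -> : kerblocks Y = 0; last by rewrite mulmx0.
  by apply/matrixP => i j; rewrite mxE -/v v0 !mxE.
by rewrite -row_free_unit /row_free mxrank0 eq_sym -lt0n.
Qed.

(** The bound over [L1] is chained with AM-GM for the eigenvalues of [invmx L2 *m S]. Taking their
    mean as the scale makes the trace term cancel [m2], so the final bound does not depend on
    [L2]. *)
Lemma loglik_leif (c := (n * m2)%:R : R) (L1 : 'M_m1) (L2 : 'M_m2) :
  (0 < n)%N -> (0 < m2)%N -> PD S -> PD L1 -> PD L2 ->
  loglik Y L1 L2 <= c * (m1%:R * ln c - m1%:R - ln m2%:R) - n%:R * ln (\det S)
    ?= iff (L1 *m scatter Y L2 == c%:M) &&
           (invmx L2 *m S == (\tr (invmx L2 *m S) / m2%:R)%:M).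
Proof.
move=> n_gt0 m2_gt0 pdS pd1 pd2; have v0 := PD_kergram_neq0 m2_gt0 pdS.
have c0 : 0 < c by rewrite ltr0n muln_gt0 n_gt0.
have m20 : 0 < m2%:R :> R by rewrite ltr0n.
have n0 : 0 < n%:R :> R by rewrite ltr0n.
have pd2' := PD_inv pd2; have tau0 := kergram_trace_gt0 v0 pd2'.
apply: leif_trans (loglik_profile c0 v0 pd1 pd2) _.
have t0 : 0 < \tr (invmx L2 *m S) / m2%:R by rewrite divr_gt0.
apply: (leif_scaled_gap n0 _ (logdet_mul_scaled_leif t0 pd2' pdS)).
rewrite det_inv lnV ?posrE ?PD_det_gt0 // lnM ?posrE ?invr_gt0 // lnV ?posrE //.
rewrite invfM invrK mulrAC mulVf ?lt0r_neq0 // mul1r /c natrM; ring.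
Qed.

Lemma scatterZ (k : R) (L : 'M_m2) : scatter Y (k *: L) = k *: scatter Y L.
Proof.
by rewrite scaler_sumr; apply: eq_bigr => i _; rewrite -scalemxAr -scalemxAl.
Qed.

Definition kronecker_MLE_formula : 'M[R]_(m2 * m1) :=
  S *t ((n * m2)%:R *: invmx (scatter Y S)).

Hypotheses (n_gt0 : (0 < n)%N) (m2_gt0 : (0 < m2)%N).
Let c : R := (n * m2)%:R.

Let c_gt0 : 0 < c. Proof. by rewrite ltr0n muln_gt0 n_gt0. Qed.

(** These are the equality conditions of [loglik_leif] at the candidate factors. *)
Lemma kronecker_MLE_factors : PD S ->
  [/\ PD (c *: invmx (scatter Y S)),
      (c *: invmx (scatter Y S)) *m scatter Y S = c%:M
    & invmx S *m S = (\tr (invmx S *m S) / m2%:R)%:M].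
Proof.
move=> pdS; have v0 := PD_kergram_neq0 m2_gt0 pdS.
have pdM := PD_scatter v0 pdS; split.
- exact/PD_scale/PD_inv.
- by rewrite -scalemxAl mulVmx ?PD_unit // scalemx1.
- by rewrite mulVmx ?PD_unit // mxtrace1 divff // pnatr_eq0 -lt0n.
Qed.

Lemma kronecker_MLE_exists : PD S -> is_kronecker_MLE Y kronecker_MLE_formula.
Proof.
move=> pdS; have [pdK1 eq1 eq2] := kronecker_MLE_factors pdS.
exists (c *: invmx (scatter Y S)), S; split=> // L1 L2 pd1 pd2.
have [le _] := loglik_leif n_gt0 m2_gt0 pdS pd1 pd2.
have [_] := loglik_leif n_gt0 m2_gt0 pdS pdK1 pdS.
by rewrite eq1 -eq2 !eqxx => /eqP ->.
Qed.

(** Any maximizer also attains the bound, so [S = k *: L2] and [L1] is determined by [L2]. Since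
    [scatter] is linear in its matrix argument, [k] cancels in the Kronecker product. *)
Lemma kronecker_MLE_unique (K : 'M_(m2 * m1)) : PD S ->
  is_kronecker_MLE Y K -> K = kronecker_MLE_formula.
Proof.
move=> pdS [L1 [L2 [pd1 pd2 -> maxL]]].
have v0 := PD_kergram_neq0 m2_gt0 pdS.
have [pdK1 eq1 eq2] := kronecker_MLE_factors pdS.
have [le eqL] := loglik_leif n_gt0 m2_gt0 pdS pd1 pd2.
have [_] := loglik_leif n_gt0 m2_gt0 pdS pdK1 pdS.
rewrite eq1 -eq2 !eqxx => /eqP valK.
have := maxL _ _ pdK1 pdS; rewrite valK => ge.
move: eqL; rewrite eq_le le ge => /esym/andP[/eqP L1M /eqP L2S].
move: L2S; set k := _ / _ => L2S.
have k0 : k != 0.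
  by rewrite lt0r_neq0 // divr_gt0 ?ltr0n ?kergram_trace_gt0 //; apply: PD_inv.
have SE : S = k *: L2.
  by rewrite -[S](mulKVmx (PD_unit pd2)) L2S mul_mx_scalar.
have uM := PD_unit (PD_scatter v0 pd2).
have L1E : L1 = c *: invmx (scatter Y L2).
  by rewrite -[L1](mulmxK uM) L1M mul_scalar_mx.
rewrite /kronecker_MLE_formula SE scatterZ invmxZ ?unitmxZ ?unitfE // L1E.
apply/matrixP => i j; rewrite !mxE; field.
by rewrite k0.
Qed.

(* When [n < m2] the likelihood can always be increased: a vector [x] with
   [x^T Y_i = 0] for all [i] lets [det K1] grow, and otherwise a null vector of
   the singular matrix [S] lets [det K2^-1] grow in the profile likelihood. *)
Lemma kronecker_MLE_none (K : 'M_(m2 * m1)) : (n < m2)%N ->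
  ~ is_kronecker_MLE Y K.
Proof.
move=> n_lt_m2 [K1 [K2 [pd1 pd2 _ maxK]]].
have [v0|v0] := eqVneq v 0.
  have [x x0 Yx0] := kervec_eq0_ker v0.
  have := maxK _ _ (PD_rank1_update x pd1) pd2; rewrite /loglik.
  have tr_eq : \sum_i (K1 + x *m x^T) *m Y i *m K2 *m (Y i)^T =
     \sum_i K1 *m Y i *m K2 *m (Y i)^T.
    have xY : x^T *m hstack Y = 0.
      by apply: trmx_inj; rewrite trmx_mul trmxK Yx0 trmx0.
    apply: eq_bigr => i _; rewrite mulmxDl -(mulmxA x).
    have -> : x^T *m Y i = 0.
      apply/rowP => j; transitivity ((x^T *m hstack Y) 0 (mxtens_index (i, j))).
        by rewrite !mxE; apply: eq_bigr => a _; rewrite !mxE mxtens_indexK.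
      by rewrite xY !mxE.
    by rewrite mulmx0 addr0.
  rewrite tr_eq lerBlDr subrK lerD2r ler_pM2l //.
  by rewrite leNgt ln_det_rank1_update.
have [u u0 Vu0] : exists2 u : 'cV_m2, u != 0 & kerblocks Y *m u = 0.
  by apply: mulmx_vanish; rewrite (leq_ltn_trans (rank_leq_row _)).
have uS : u^T *m S = 0.
  by rewrite mulmxA -trmx_mul Vu0 trmx0 mul0mx.
pose P := invmx K2 + u *m u^T.
have pdK2' := PD_inv pd2; have pdP : PD P by exact: PD_rank1_update.
have pdL2 := PD_inv pdP; pose M := scatter Y (invmx P).
have pdM : PD M by exact: PD_scatter.
have pdL1 : PD (c *: invmx M) by exact/PD_scale/PD_inv.
(* The profile bound holds at [(K1, K2)] and is attained at [(c *: invmx M, invmx P)]. The traces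
   agree because [u^T *m S = 0], so maximality would give [\det P <= \det (invmx K2)]. *)
have [le _] := loglik_profile c_gt0 v0 pd1 pd2.
have [_] := loglik_profile c_gt0 v0 pdL1 pdL2.
rewrite -scalemxAl mulVmx ?PD_unit // scalemx1 eqxx => /eqP val.
have := le_trans (maxK _ _ pdL1 pdL2) le; rewrite val invmxK mulmxDl.
rewrite -(mulmxA u) uS mulmx0 addr0 lerBlDr subrK lerD2l lerN2.
rewrite ler_pM2l ?ltr0n // leNgt.
have := ln_det_rank1_update pdK2' u0.
by rewrite -/P !det_inv !lnV ?posrE ?PD_det_gt0 // ltrNl => ->.
Qed.

End Gram.

(** * Genericity and rationality *)

Section Genericity.
Variables (R : realType) (m1 m2 n : nat) (e : (m1 + 1)%N = (n * m2)%N).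
Hypotheses (m2_gt0 : (0 < m2)%N) (n_ge : (m2 <= n)%N).

Lemma PD_kergram (Y : 'I_n -> 'M[R]_(m1, m2)) : \det (kergram e Y) != 0 ->
  PD (kergram e Y).
Proof.
move=> detS; rewrite /kergram -[(kerblocks e Y)^T]mulmx1.
apply: PD_congr => [|x Vx0]; first exact: PD1.
have /unitmx_inj : kergram e Y \in unitmx by rewrite unitmxE unitfE.
by apply; rewrite -mulmxA Vx0 mulmx0.
Qed.

Lemma exists_kergram_neq0 : exists Y : 'I_n -> 'M[R]_(m1, m2), \det (kergram e Y) != 0.
Proof.
(* The blocks of [t] form the [n] by [m2] matrix whose last [m2] rows are the identity and whose
   other rows vanish. Its last entry is 1, as [kervec_onto] requires. Writing the condition with
   sums avoids truncated subtraction. *)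
pose t : 'cV[R]_(n * m2) := \col_k
  (((mxtens_unindex k).1 + m2)%N == ((mxtens_unindex k).2 + n)%N)%:R.
have [|Z ZE] := @kervec_onto R m1 _ e t.
  have n1 : (n.-1 < n)%N by lia.
  have m21 : (m2.-1 < m2)%N by lia.
  have -> : cast_ord e (rshift m1 0) = mxtens_index (Ordinal n1, Ordinal m21).
    apply: val_inj => /=; rewrite addn0.
    case: n m2 e m2_gt0 n_ge => [|n'] [|m2'] //=; nia.
  by rewrite mxE mxtens_indexK /= (_ : _ == _) //; apply/eqP; lia.
pose Y i := \matrix_(a < m1, j < m2) Z a (mxtens_index (i, j)).
have hY : hstack Y = Z.
  apply/matrixP => a k; case: (mxtens_indexP k) => i j.
  by rewrite !mxE mxtens_indexK.
have VE i j : kerblocks e Y i j = ((i + m2)%N == (j + n)%N)%:R.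
  by rewrite [LHS]mxE hY ZE mxE mxtens_indexK.
exists Y; suff : PD (kergram e Y) by move/PD_det_gt0/lt0r_neq0.
rewrite /kergram -[(kerblocks e Y)^T]mulmx1.
apply: PD_congr => [|x Vx0]; first exact: PD1.
apply/colP => j; rewrite [RHS]mxE.
(* Row [j + (n - m2)] reads off coordinate [j] of [x]. *)
have jn : (j + n - m2 < n)%N by have := ltn_ord j; lia.
move/colP/(_ (Ordinal jn)): Vx0; rewrite mxE (bigD1 j) //= big1 => [|k kj].
  rewrite VE mxE addr0 (_ : _ == _) ?mul1r //=.
  by apply/eqP; lia.
rewrite VE (_ : (_ == _) = false) ?mul0r //=.
apply: contraNF kj => /eqP E; apply/eqP/val_inj => /=; lia.
Qed.

Let N := (n * (m1 * m2))%N.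

(** The entries are distinct indeterminates, numbered as in [sample_of], so that evaluation at [y]
    yields the sample. *)
Definition generic_sample (i : 'I_n) : 'M[mpoly N R]_(m1, m2) :=
  \matrix_(a, j) mpolyX R (mnm1 (mxvec_index i (mxvec_index a j))).

Definition at_sample (y : 'rV[R]_N) : {rmorphism mpoly N R -> R} :=
  meval (fun k => y 0 k).

Lemma map_generic_sample (y : 'rV[R]_N) (i : 'I_n) :
  map_mx (at_sample y) (generic_sample i) = sample_of y i.
Proof. by apply/matrixP => a j; rewrite !mxE /= mevalXU. Qed.

Lemma map_kergram_generic (y : 'rV[R]_N) :
  map_mx (at_sample y) (kergram e generic_sample) = kergram e (sample_of y).
Proof.
rewrite map_kergram; congr (kergram e _).
by apply: funext => i; rewrite map_generic_sample.
Qed.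

(** The exceptional variety is the hypersurface where the polynomial [\det S] vanishes; it is proper
    by [exists_kergram_neq0]. *)
Lemma generically_det_kergram (P : 'rV[R]_N -> Prop) :
  (forall y, \det (kergram e (sample_of y)) != 0 -> P y) -> generically P.
Proof.
move=> HP; pose p := \det (kergram e generic_sample).
have pE y : peval p y = \det (kergram e (sample_of y)).
  by rewrite -map_kergram_generic det_map_mx.
exists [set y : 'rV[R]_N | forall q, q \in [:: p] -> peval q y = 0]%classic.
split; first by exists [:: p].
- have [Y detY] := exists_kergram_neq0.
  pose y : 'rV[R]_N := mxvec (\matrix_(i < n) mxvec (Y i)).
  have yE : sample_of y = Y.
    by apply: funext => i; rewrite /sample_of mxvecK rowK mxvecK.
  move=> VT; have : [set: 'rV[R]_N]%classic y by [].
  rewrite -VT => /(_ p); rewrite mem_seq1 eqxx => /(_ isT).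
  by rewrite pE yE; apply/eqP.
- move=> y Vy; apply: HP; apply/eqP => det0; apply: Vy => q.
  by rewrite mem_seq1 => /eqP ->; rewrite pE.
Qed.

Lemma kronecker_MLE_rational_holds : kronecker_MLE_rational R m1 m2 n.
Proof.
have n_gt0 : (0 < n)%N by exact: leq_trans n_ge.
pose S := kergram e generic_sample; pose M := scatter generic_sample S.
(* By Cramer's rule [invmx M] is [\adj M] divided by [\det M], so all entries share the denominator
   [\det M], which is positive wherever [S] is invertible. *)
exists (fun a b => S (mxtens_unindex a).1 (mxtens_unindex b).1 *
   ((n * m2)%:R * \adj M (mxtens_unindex a).2 (mxtens_unindex b).2)).
exists (fun a b => \det M); apply: generically_det_kergram => y detS.
have pdS := PD_kergram detS.
have v0 := PD_kergram_neq0 m2_gt0 pdS.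
have pdM := PD_scatter v0 pdS.
have ME : map_mx (at_sample y) M = scatter (sample_of y) (kergram e (sample_of y)).
  rewrite map_scatter map_kergram_generic; congr (scatter _ _).
  by apply: funext => i; rewrite map_generic_sample.
have detM : peval (\det M) y = \det (scatter (sample_of y) (kergram e (sample_of y))).
  by rewrite -ME det_map_mx.
split=> [_ _|]; first by rewrite detM lt0r_neq0 // PD_det_gt0.
have := kronecker_MLE_exists n_gt0 m2_gt0 pdS; congr (is_kronecker_MLE _ _).
have SE i j : peval (S i j) y = kergram e (sample_of y) i j.
  by rewrite -map_kergram_generic [RHS]mxE.
have adjE i j : peval (\adj M i j) y =
    \adj (scatter (sample_of y) (kergram e (sample_of y))) i j.
  by rewrite -ME -map_mx_adj [RHS]mxE.
apply/matrixP => a b; rewrite [LHS]mxE [RHS]mxE detM /invmx PD_unit //.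
rewrite [X in _ * X]mxE [X in _ * (_ * X)]mxE -SE -adjE.
have pevalM p q : peval (p * q) y = peval p y * peval q y.
  exact: (rmorphM (at_sample y)).
have peval_nat k : peval k%:R y = k%:R by exact: (rmorph_nat (at_sample y)).
by rewrite !pevalM peval_nat; ring.
Qed.

End Genericity.

Theorem theorem1p4 (R : realType) (m1 m2 n : nat)
    (m1_gt0 : (0 < m1)%N) (m2_gt0 : (0 < m2)%N) (n_gt0 : (0 < n)%N)
    (dim_eq : (m1 + 1)%N = (n * m2)%N) :
  (kronecker_MLE_generically_unique R m1 m2 n <-> (m2 <= n)%N) /\
  ((m2 <= n)%N -> kronecker_MLE_rational R m1 m2 n).
Proof.
split; last exact: kronecker_MLE_rational_holds.
split=> [[V [_ VT HV]]|n_ge].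
  (* If [n < m2], no sample has a maximizer, so the exceptional variety would be the whole space. *)
  rewrite leqNgt; apply/negP => n_lt; apply: VT; apply/seteqP; split=> // y _.
  apply: contrapT => /HV[K [mleK _]].
  exact: (kronecker_MLE_none dim_eq n_gt0 m2_gt0 n_lt mleK).
apply: (generically_det_kergram (e := dim_eq) m2_gt0 n_ge) => y /PD_kergram pdS.
exists (kronecker_MLE_formula dim_eq (sample_of y)); split.
  exact: kronecker_MLE_exists.
by move=> K /(kronecker_MLE_unique n_gt0 m2_gt0 pdS).
Qed.
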